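(* Let $K$ be a field, $R=K[x_1,\ldots,x_n]$, and let $I\subset R$ be a matroidal ideal, i.e. a squarefree monomial ideal such that the set $\{\mathrm{supp}(u) : u\in G(I)\}$ is the set of bases of a matroid on (a subset of) $\{1,\ldots,n\}$. Then $I$ has a regular decomposition function; that is, there is an order $u_1,\ldots,u_m$ of the elements of $G(I)$ with respect to which $I$ has linear quotients and for which the associated decomposition function $g\colon M(I)\to G(I)$ is regular.
   Context: $G(I)$ denotes the unique minimal set of monomial generators of the monomial ideal $I$, $M(I)$ the set of all monomials in $I$, and $\mathrm{supp}(u)=\{i : x_i \text{ divides } u\}$ for a monomial $u$. The ideal $I$ has linear quotients with respect to the order $u_1,\ldots,u_m$ of the elements of $G(I)$ if for all $j=1,\ldots,m$ the colon ideal $(u_1,\ldots,u_{j-1}):u_j$ is generated by a subset of $\{x_1,\ldots,x_n\}$. For $j=1,\ldots,m$ set $$\mathrm{set}(u_j)=\{k\in\{1,\ldots,n\} : x_k\in (u_1,\ldots,u_{j-1}):u_j\}.$$ Put $I_j=(u_1,\ldots,u_j)$. The decomposition function $g\colon M(I)\to G(I)$ (with respect to the given order) is defined by $g(u)=u_j$, where $j$ is the smallest number such that $u\in I_j$. It is called regular if $\mathrm{set}(g(x_su))\subset \mathrm{set}(u)$ for all $u\in G(I)$ and all $s\in \mathrm{set}(u)$. *)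

(* Defs.v *)
From HB Require Import structures.
From mathcomp Require Import all_boot all_order all_algebra.
From mathcomp Require Import mpoly.

Set Implicit Arguments.
Unset Strict Implicit.
Unset Printing Implicit Defensive.

Import GRing.Theory.

Local Open Scope ring_scope.

(* Ideals are [Prop]-valued predicates, and may be improper: the unit ideal is
   matroidal (it comes from the matroid of rank 0), whereas the [idealr]
   structure of [ring_quotient] only covers proper decidable ideals. *)
Section Ideals.
Variable A : comNzRingType.
Implicit Types (J S : A -> Prop) (f : A).

Definition is_ideal J : Prop :=
  [/\ J 0,
      forall p q, J p -> J q -> J (p + q)
    & forall a p, J p -> J (a * p)].

Definition ideal_gen S : A -> Prop :=
  fun p => forall J, is_ideal J -> (forall q, S q -> J q) -> J p.

Definition generates S J : Prop := forall p, J p <-> ideal_gen S p.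

Definition colon J f : A -> Prop := fun p => J (p * f).

End Ideals.

Definition matroid_bases (T : finType) (E : {set T}) (B : {set {set T}}) : Prop :=
  [/\ B != set0,
      forall X, X \in B -> X \subset E
    & forall X Y, X \in B -> Y \in B -> forall x, x \in X :\: Y ->
        exists2 y, y \in Y :\: X & y |: (X :\ x) \in B].

(* A monomial is given by its exponent vector [u : 'X_{1..n}]; the polynomial
   itself is ['X_[u]], and products of monomials are sums of exponents. *)
Section MonomialIdeals.
Variables (K : fieldType) (n : nat).
Implicit Types (I : {mpoly K[n]} -> Prop) (S : 'X_{1..n} -> Prop).
Implicit Types (u : 'X_{1..n}) (us : seq 'X_{1..n}) (g : 'X_{1..n} -> 'X_{1..n}).

Definition monomials_of S : {mpoly K[n]} -> Prop :=
  fun p => exists2 u, S u & p = 'X_[u].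

Definition mon_generates S I : Prop := generates (monomials_of S) I.

Definition minimal_mon_generators I S : Prop :=
  mon_generates S I /\
  forall S', (forall u, S' u -> S u) -> mon_generates S' I ->
    forall u, S u -> S' u.

(* A monomial ideal has exactly one [S] such that [minimal_mon_generators I S],
   so this is that [S]. *)
Definition min_gens I : 'X_{1..n} -> Prop :=
  fun u => exists2 S, minimal_mon_generators I S & S u.

Definition monomials_in I : 'X_{1..n} -> Prop := fun u => I 'X_[u].

Definition supp u : {set 'I_n} := [set i | (U_(i) <= u)%MM].

Definition squarefree u : Prop := forall i, (u i <= 1)%N.

Definition squarefree_monomial_ideal I : Prop :=
  exists2 S, (forall u, S u -> squarefree u) & mon_generates S I.

Definition matroidal I : Prop :=
  squarefree_monomial_ideal I /\
  exists (E : {set 'I_n}) (B : {set {set 'I_n}}),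
    matroid_bases E B /\
    forall X, X \in B <-> exists2 u, min_gens I u & supp u = X.

Definition enumerates_min_gens us I : Prop :=
  uniq us /\ forall u, u \in us <-> min_gens I u.

Definition initial_ideal us j : {mpoly K[n]} -> Prop :=
  ideal_gen (monomials_of (fun u => u \in take j us)).

(* [us] is indexed from 0: with [u_j] at position [j - 1], the ideal
   (u_1, ..., u_(j-1)) is [initial_ideal us (j - 1)]. *)
Definition initial_colon us u : {mpoly K[n]} -> Prop :=
  colon (initial_ideal us (index u us)) 'X_[u].

Definition linear_quotients us : Prop :=
  forall u, u \in us -> exists V : {set 'I_n},
    generates (fun p => exists2 k, k \in V & p = 'X_k) (initial_colon us u).

Definition set_of us u : 'I_n -> Prop := fun k => initial_colon us u 'X_k.

(* [g] is only constrained on the monomials of [I]. *)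
Definition decomposition_function us I g : Prop :=
  forall u, monomials_in I u ->
    exists j, [/\ (1 <= j <= size us)%N,
      initial_ideal us j 'X_[u],
      forall i, (1 <= i < j)%N -> ~ initial_ideal us i 'X_[u]
    & g u = nth 0%MM us j.-1].

Definition regular us I g : Prop :=
  forall u s, min_gens I u -> set_of us u s ->
    forall k, set_of us (g (U_(s) + u)%MM) k -> set_of us u k.

End MonomialIdeals.

Arguments linear_quotients K {n} us.

(* Main.v *)
(* Identify the generators with the bases of the matroid and order them by
   reverse lexicographic order: X precedes Y when the largest element of their
   symmetric difference lies in Y.  If X precedes Y, exchanging that largest
   element y yields k in X \ Y with k < y and Y - y + k a basis, so
   set(Y) = {k not in Y | Y - y + k is a basis for some y in Y with y > k}
   and the colon ideal at Y is generated by these variables.  For s in set(Y),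
   g(x_s Y) = Y - m + s with m as large as possible, and set(Y - m + s) is
   contained in set(Y) by two applications of basis exchange. *)
Require Import Defs.
From mathcomp Require Import all_boot all_order all_algebra.
From mathcomp Require Import mpoly.

Set Implicit Arguments.
Unset Strict Implicit.
Unset Printing Implicit Defensive.

(** * Exchange properties of matroid bases *)

(* As a binary number, so that [weight] orders sets reverse lexicographically. *)
Definition weight n (X : {set 'I_n}) : nat := \sum_(i in X) 2 ^ i.

(** For a basis [Y] of a matroid these are the externally passive elements, activity of [k] meaning
    that [k] is the largest element of its fundamental circuit in [Y + k]. *)
Definition passive n (B : {set {set 'I_n}}) (Y : {set 'I_n}) : {set 'I_n} :=
  [set k | (k \notin Y) && [exists y in Y, (k < y) && (k |: Y :\ y \in B)]].

Lemma passiveP n (B : {set {set 'I_n}}) (Y : {set 'I_n}) k :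
  reflect (k \notin Y /\ exists y, [/\ y \in Y, k < y & k |: Y :\ y \in B])
          (k \in passive B Y).
Proof.
rewrite inE; apply: (iffP andP) => -[kY].
  by move/exists_inP=> [y yY /andP[]]; split=> //; exists y.
by case=> y [yY lt_ky ZB]; split=> //; apply/exists_inP; exists y; rewrite ?lt_ky.
Qed.

Lemma bases_exchange (T : finType) (E : {set T}) (B : {set {set T}}) X Y x :
    matroid_bases E B -> X \in B -> Y \in B -> x \in X -> x \notin Y ->
  exists y, [/\ y \in Y, y \notin X & y |: X :\ x \in B].
Proof.
move=> [_ _ exch] XB YB xX xY.
have [|y] := exch X Y XB YB x; first by rewrite inE xY.
by rewrite inE => /andP[yX yY] ?; exists y.
Qed.

Lemma bases_antichain (T : finType) (E : {set T}) (B : {set {set T}}) X Y :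
  matroid_bases E B -> X \in B -> Y \in B -> X \subset Y -> X = Y.
Proof.
move=> BB XB YB sXY; apply/eqP; rewrite eqEsubset sXY; apply/subsetP=> y yY.
apply: contraT => yX; have [x [xX]] := bases_exchange BB YB XB yY yX.
by rewrite (subsetP sXY x xX).
Qed.

Lemma expn2_weight n (X : {set 'I_n}) x : x \in X -> 2 ^ x <= weight X.
Proof. by move=> xX; rewrite /weight (bigD1 x) //= leq_addr. Qed.

Lemma weight_lt n (X : {set 'I_n}) m :
  (forall x, x \in X -> x < m) -> weight X < 2 ^ m.
Proof.
elim: m X => [|m IHm] X ltXm.
  by rewrite /weight big1 // => x /ltXm.
(* [m] may be too large to be an index; then every element is already below [m]. *)
have [m_lt_n|n_le_m] := ltnP m n; last first.
  apply: leq_trans (IHm X _) _ => [x _|]; last by rewrite leq_exp2l.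
  exact: leq_trans (ltn_ord x) n_le_m.
have ltXm' x : x \in X :\ Ordinal m_lt_n -> x < m.
  by rewrite !inE -val_eqE /= ltn_neqAle -ltnS => /andP[-> /ltXm].
have := IHm _ ltXm'; rewrite expnS mul2n -addnn.
have [mX|mX] := boolP (Ordinal m_lt_n \in X).
  by rewrite {2}/weight (big_setD1 _ mX) /= -/(weight _) ltn_add2l.
suff -> : X :\ Ordinal m_lt_n = X by exact: ltn_addr.
by apply/setDidPl; rewrite disjoint_sym disjoints1.
Qed.

Lemma weight_swap n (Y : {set 'I_n}) y k :
  y \in Y -> k \notin Y -> k < y -> weight (k |: Y :\ y) < weight Y.
Proof.
move=> yY kY lt_ky; rewrite /weight (big_setD1 y yY) big_setU1 ?inE /=; last first.
  by rewrite (negPf kY) andbF.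
by rewrite ltn_add2r ltn_exp2l.
Qed.

(** Let [x] be the largest element of [X \ Y], nonempty because bases form an antichain. Some [y] in
    [Y \ X] exceeds [x], and exchanging [y] brings in some [k] of [X \ Y], so that [k <= x < y]. *)
Lemma light_basis_exchange n (E : {set 'I_n}) (B : {set {set 'I_n}}) X Y :
    matroid_bases E B -> X \in B -> Y \in B -> X != Y -> weight X <= weight Y ->
  exists y k, [/\ y \in Y, y \notin X, k \in X, k \notin Y & k < y]
              /\ k |: Y :\ y \in B.
Proof.
move=> BB XB YB neqXY leXY.
have [x0 x0D]: exists x, x \in X :\: Y.
  apply/set0Pn; apply: contra neqXY; rewrite setD_eq0 => sXY.
  by rewrite (bases_antichain BB XB YB sXY).
case: (arg_maxnP (fun i : 'I_n => i : nat) x0D) => x xD max_x.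
have /setDP[xX xY] := xD.
(* Otherwise all of [Y \ X] lies below [x] and weighs less than [2 ^ x], hence less than [X \ Y],
   while the common part contributes equally. *)
have [y yD lt_xy]: exists2 y, y \in Y :\: X & x < y.
  apply/exists_inP; apply: contraLR leXY; rewrite negb_exists_in -ltnNge.
  move=> /forall_inP nlt.
  rewrite /weight (big_setID X) [ltnRHS](big_setID Y) /= setIC ltn_add2l.
  apply: leq_trans (expn2_weight xD); apply: weight_lt => y yD.
  have := nlt y yD; rewrite -leqNgt leq_eqVlt => /predU1P[/val_inj yx|//].
  by case/setDP: yD => _; rewrite yx xX.
have /setDP[yY yX] := yD.
have [k [kX kY ZB]] := bases_exchange BB YB XB yY yX.
exists y, k; split=> //; split=> //; apply: leq_ltn_trans lt_xy.
by apply: max_x; apply/setDP.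
Qed.

(** This is the matroid content of regularity. If [l] is passive for [Y - m + s] through [z],
    exchanges between [Y] and the basis [W = Y - m + s - z + l] show that [l] is passive for [Y]
    through [m] or [z]. *)
Lemma passive_exchange n (E : {set 'I_n}) (B : {set {set 'I_n}}) Y s m :
    matroid_bases E B -> Y \in B -> s \notin Y -> m \in Y -> s < m ->
    s |: Y :\ m \in B ->
    (forall y, y \in Y -> m < y -> s |: Y :\ y \notin B) ->
  passive B (s |: Y :\ m) \subset passive B Y.
Proof.
move=> BB YB sY mY lt_sm ZB max_m; apply/subsetP=> l /passiveP[lZ [z [zZ lt_lz WB]]].
have sm: s != m by apply: contraNneq sY => ->.
have ls: l != s by apply: contraNneq lZ => ->; rewrite !inE eqxx.
(* If [z = s], then [W = Y - m + l] and [l < s < m]. *)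
have [zs|zs] := eqVneq z s.
  have lt_lm: l < m by apply: ltn_trans lt_sm; rewrite -zs.
  have lm: l != m by rewrite -val_eqE /= neq_ltn lt_lm.
  apply/passiveP; split; first by apply: contra lZ => lY; rewrite !inE lY lm orbT.
  exists m; split=> //; congr (_ \in B): WB; apply/setP=> i; rewrite !inE zs.
  by case: (eqVneq i s) => [->|//]; rewrite (negPf sY) andbF.
have [zm zY]: z != m /\ z \in Y by move: zZ; rewrite !inE (negPf zs) => /andP[].
(* If [l = m], then [W = Y - z + s] with [m < z], against the maximality of [m]. *)
have lm: l != m.
  apply: contraTneq WB => lm; move: lt_lz; rewrite lm => /(max_m z zY).
  congr (_ \notin B); apply/setP=> i; rewrite !inE.
  case: (eqVneq i m) => [->|_]; first by rewrite [m == z]eq_sym zm mY orbT.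
  by case: (eqVneq i s) => [->|//]; rewrite [s == z]eq_sym zs.
have lY: l \notin Y by move: lZ; rewrite !inE (negPf ls) lm.
have lz: l != z by apply: contraNneq lY => ->.
have WE i : (i \in l |: (s |: Y :\ m) :\ z) =
    [|| i == l, i == s | [&& i != z, i != m & i \in Y]].
  by rewrite !inE; case: (eqVneq i s) => [->|//]; rewrite [s == z]eq_sym zs !orbT.
apply/passiveP; split=> //.
(* Either Y - z + l is a basis, or w = s and then z < m by the choice of m;
   exchanging s in W = Y - m + s - z + l then gives Y - m + l or Y - z + l. *)
have [|w [wW wY VB]] := bases_exchange BB YB WB zY.
  by rewrite WE eqxx eq_sym (negPf lz) (negPf zs).
have [wl|wl] := eqVneq w l; first by exists z; rewrite -wl; split=> //; rewrite wl.
have ws: w = s by move: wW; rewrite WE (negPf wl) (negPf wY) !andbF orbF => /eqP.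
have lt_zm: z < m.
  rewrite ltn_neqAle val_eqE zm leqNgt; apply: contraL VB; rewrite ws; exact: max_m.
have [|y [yY yW UB]] := bases_exchange BB WB YB _ sY; first by rewrite WE eqxx orbT.
have UE i : (i \in (l |: (s |: Y :\ m) :\ z) :\ s) =
    (i == l) || [&& i != z, i != m & i \in Y].
  rewrite in_setD1 WE; case: (eqVneq i s) => [->|//].
  by rewrite (negPf sY) !andbF orbF eq_sym (negPf ls).
(* Only [z] and [m] lie in [Y \ W]. For [y = z] the witness is [m], as [l < z < m]. *)
have [yz|yz] := eqVneq y z.
  exists m; split=> //; first exact: ltn_trans lt_lz lt_zm.
  congr (_ \in B): UB; apply/setP=> i; rewrite in_setU1 UE !inE yz.
  by case: (eqVneq i z) => [->|_]; rewrite ?zm ?zY ?orbT.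
have ym: y = m.
  by move: yW; rewrite WE yY yz andbT /= !negb_or negbK => /and3P[_ _ /eqP].
exists z; split=> //; congr (_ \in B): UB; apply/setP=> i; rewrite in_setU1 UE !inE ym.
by case: (eqVneq i m) => [->|_]; rewrite /= ?[m == z]eq_sym ?zm ?mY ?orbT.
Qed.

(** * Ideals generated by monomials *)

Import GRing.Theory.
Local Open Scope ring_scope.

Lemma ideal_gen_ideal (A : comNzRingType) (S : A -> Prop) : is_ideal (ideal_gen S).
Proof.
split=> [J [J0 _ _] //|p q Sp Sq J JJ SJ|a p Sp J JJ SJ]; have [_ JD JM] := JJ.
  by apply: JD; [apply: Sp|apply: Sq].
by apply: JM; apply: Sp.
Qed.

Lemma ideal_gen_sub (A : comNzRingType) (S : A -> Prop) p : S p -> ideal_gen S p.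
Proof. by move=> Sp J _; apply. Qed.

(** The polynomials described on the right form an ideal containing the generators, which serves as
    [J] in [ideal_gen]; conversely each term of such a [p] is a multiple of a generator. *)
Lemma mon_ideal_genP (K : fieldType) n (S : 'X_{1..n} -> Prop) (p : {mpoly K[n]}) :
  ideal_gen (monomials_of S) p <->
  forall m, m \in msupp p -> exists2 u, S u & (u <= m)%MM.
Proof.
split=> [Sp|Sp].
  apply: (Sp (fun q => forall m, m \in msupp q -> exists2 u, S u & (u <= m)%MM)); last first.
    by move=> _ [u Su ->] m; rewrite msuppX inE => /eqP->; exists u; rewrite ?lepm_refl.
  split=> [m|q r Sq Sr m|a q Sq m].
  - by rewrite msupp0.
  - by move/msuppD_le; rewrite mem_cat => /orP[/Sq|/Sr].
  - move/msuppM_le=> /allpairsP[[m1 m2] /= [_ /Sq[u Su le_u] ->]].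
    by exists u => //; apply: lepm_trans le_u (lem_addl _ _).
have [J0 JD JM] := ideal_gen_ideal (@monomials_of K n S).
rewrite (mpolyE p) big_seq; apply: (big_ind (ideal_gen (monomials_of S))) => // m /Sp[u Su le_u].
rewrite -mul_mpolyC -(submK le_u) mpolyXD mulrA; apply: JM; apply: ideal_gen_sub.
by exists u.
Qed.

Lemma mon_ideal_genX (K : fieldType) n (S : 'X_{1..n} -> Prop) m :
  ideal_gen (@monomials_of K n S) 'X_[m] <-> exists2 u, S u & (u <= m)%MM.
Proof.
rewrite mon_ideal_genP msuppX; split=> [|Sm m']; first by apply; rewrite inE.
by rewrite inE => /eqP->.
Qed.

Lemma mon_generatesX (K : fieldType) n S (I : {mpoly K[n]} -> Prop) m :
  mon_generates S I -> I 'X_[m] <-> exists2 u, S u & (u <= m)%MM.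
Proof. by move=> /(_ 'X_[m]) ->; apply: mon_ideal_genX. Qed.

(** * Minimal monomial generators *)

Lemma lepm_antisym n (u v : 'X_{1..n}) : (u <= v)%MM -> (v <= u)%MM -> u = v.
Proof.
by move=> /mnm_lepP uv /mnm_lepP vu; apply/mnmP=> i; apply/eqP; rewrite eqn_leq uv vu.
Qed.

(** If [u] properly divided [v], then [S] without [v] would still generate [I], against
    minimality. *)
Lemma minimal_mon_generators_antichain (K : fieldType) n (I : {mpoly K[n]} -> Prop) S u v :
  minimal_mon_generators I S -> S u -> S v -> (u <= v)%MM -> u = v.
Proof.
move=> [SI minS] Su Sv le_uv; apply/eqP; apply: contraT => neq_uv.
suff [_ /eqP//] : S v /\ v <> v.
apply: (minS (fun w => S w /\ w <> v)) => // [w []//|p]; rewrite (SI p) !mon_ideal_genP.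
split=> Sp m /Sp[w]; last by case; exists w.
move=> Sw le_wm; have [wv|/eqP] := eqVneq w v; last by exists w.
by exists u; [split=> //; apply/eqP|apply: lepm_trans le_uv _; rewrite -wv].
Qed.

(** Some [v] in [S'] divides [u], and some [w] in [S] divides [v]; the antichain property gives
    [w = u], which squeezes [v] to [u]. *)
Lemma minimal_mon_generators_sub (K : fieldType) n (I : {mpoly K[n]} -> Prop) S S' u :
  minimal_mon_generators I S -> mon_generates S' I -> S u -> S' u.
Proof.
move=> mS S'I Su; have [SI _] := mS.
have /(mon_generatesX _ S'I)[v S'v le_vu]: I 'X_[u].
  by apply/(mon_generatesX _ SI); exists u; rewrite ?lepm_refl.
have /(mon_generatesX _ SI)[w Sw le_wv]: I 'X_[v].
  by apply/(mon_generatesX _ S'I); exists v; rewrite ?lepm_refl.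
have wu := minimal_mon_generators_antichain mS Sw Su (lepm_trans le_wv le_vu).
by rewrite (@lepm_antisym _ u v) // -wu.
Qed.

(** The element [u] supplies a minimal generating set [S]; every other one is contained in [S], so
    [min_gens I] generates the same ideal. *)
Lemma min_gens_generate (K : fieldType) n (I : {mpoly K[n]} -> Prop) u :
  min_gens I u -> mon_generates (min_gens I) I.
Proof.
case=> S mS _ p; have [SI _] := mS; rewrite (SI p) !mon_ideal_genP.
split=> Sp m /Sp[v Sv le_vm]; exists v => //; first by exists S.
by case: Sv => S' mS' /(minimal_mon_generators_sub mS' SI).
Qed.

(** * Squarefree monomials as sets of variables *)

Definition squarefree_mon n (X : {set 'I_n}) : 'X_{1..n} :=
  [multinom (i \in X : nat) | i < n].

Lemma squarefree_mon_inj n : injective (@squarefree_mon n).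
Proof.
move=> X Y /mnmP eqXY; apply/setP=> i.
by have := eqXY i; rewrite !mnmE; do 2!case: (_ \in _).
Qed.

Lemma squarefree_mon_supp n (u : 'X_{1..n}) :
  squarefree u -> squarefree_mon (supp u) = u.
Proof.
move=> sfu; apply/mnmP=> i; rewrite mnmE inE lep1mP.
by case: (u i) (sfu i) => [|[]].
Qed.

Lemma squarefree_mon_le n (X : {set 'I_n}) (u : 'X_{1..n}) :
  (squarefree_mon X <= u)%MM = (X \subset supp u).
Proof.
apply/mnm_lepP/subsetP => [leXu i iX|sXu i].
  by rewrite inE lep1mP -lt0n; have := leXu i; rewrite mnmE iX.
by rewrite mnmE; case: (boolP (i \in X)) => [/sXu|//]; rewrite inE lep1mP lt0n.
Qed.

Lemma supp_addm_squarefree_mon n (u : 'X_{1..n}) (Y : {set 'I_n}) :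
  supp (u + squarefree_mon Y)%MM = supp u :|: Y.
Proof.
apply/setP=> i; rewrite !inE !lep1mP mnmDE mnmE addn_eq0 negb_and.
by case: (i \in Y).
Qed.

Lemma supp1 n (k : 'I_n) : supp U_(k)%MM = [set k].
Proof. by apply/setP=> i; rewrite !inE lep1mP mnm1E eqb0 negbK eq_sym. Qed.

(** A minimal generator belongs to every monomial generating set, hence to a squarefree one, so its
    support determines it. *)
Lemma matroidal_min_gens (K : fieldType) n (I : {mpoly K[n]} -> Prop) :
  matroidal I ->
  exists E B, [/\ matroid_bases E B,
    forall u, min_gens I u <-> exists2 X, X \in B & u = squarefree_mon X
    & mon_generates (min_gens I) I].
Proof.
move=> [[S sfS SI] [E [B [BB suppB]]]]; exists E, B.
have sf_min u : min_gens I u -> squarefree u.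
  by case=> S' mS' S'u; exact: sfS (minimal_mon_generators_sub mS' SI S'u).
split=> // [u|].
  split=> [Iu|[X /suppB[v Iv <-] ->]]; last by rewrite squarefree_mon_supp //; apply: sf_min.
  by exists (supp u); [apply/suppB; exists u|rewrite squarefree_mon_supp //; apply: sf_min].
(* A matroid has a basis, which yields the minimal generator that [min_gens_generate] asks for. *)
have [/set0Pn[X /suppB[u Iu _]] _ _] := BB.
exact: min_gens_generate Iu.
Qed.

(** * Initial ideals, their colon ideals and linear quotients *)

Lemma initial_idealX (K : fieldType) n (us : seq 'X_{1..n}) j m :
  @initial_ideal K n us j 'X_[m] <-> has (fun u => u <= m)%MM (take j us).
Proof.
rewrite /initial_ideal mon_ideal_genX.
by split=> [[u ? ?]|/hasP[u ? ?]]; [apply/hasP|]; exists u.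
Qed.

Lemma initial_colonP (K : fieldType) n (us : seq 'X_{1..n}) u (p : {mpoly K[n]}) :
  initial_colon us u p <->
  forall m, m \in msupp p ->
    exists2 v, v \in take (index u us) us & (v <= m + u)%MM.
Proof.
rewrite /initial_colon /colon /initial_ideal mon_ideal_genP.
have E := perm_mem (msuppMX p u); split=> Sp m.
  by move=> mp; apply: Sp; rewrite E addmC; apply: map_f.
by rewrite E => /mapP[m' /Sp[v vus le_v] ->]; exists v; rewrite 1?addmC.
Qed.

Lemma ideal_gen_variablesP (K : fieldType) n (V : {set 'I_n}) (p : {mpoly K[n]}) :
  ideal_gen (fun q => exists2 k, k \in V & q = 'X_k) p <->
  forall m, m \in msupp p -> exists2 k, k \in V & k \in supp m.
Proof.
pose S u := exists2 k, k \in V & u = U_(k)%MM.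
have E q : monomials_of (K := K) S q <-> exists2 k, k \in V & q = 'X_k.
  by split=> [[u [k kV ->] ->]|[k kV ->]]; [exists k|exists U_(k)%MM => //; exists k].
have -> : ideal_gen (fun q => exists2 k, k \in V & q = 'X_k) p <->
          ideal_gen (monomials_of S) p.
  by split=> Vp J JJ SJ; apply: Vp => // q /E; apply: SJ.
rewrite mon_ideal_genP; split=> Vp m /Vp.
  by case=> u [k kV ->] le_km; exists k; rewrite ?inE.
by case=> k kV; rewrite inE => le_km; exists U_(k)%MM => //; exists k.
Qed.

Definition sort_bases n (B : {set {set 'I_n}}) : seq {set 'I_n} :=
  sort (relpre (@weight n) leq) (enum B).

Lemma mem_sort_bases n (B : {set {set 'I_n}}) : sort_bases B =i B.
Proof. by move=> X; rewrite mem_sort mem_enum. Qed.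

Lemma weight_sort_bases n (B : {set {set 'I_n}}) X Y :
    X \in B -> Y \in B -> (index X (sort_bases B) <= index Y (sort_bases B))%N ->
  (weight X <= weight Y)%N.
Proof.
rewrite -!mem_sort_bases; apply: (@sorted_leq_index _ (relpre (@weight n) leq)).
- by move=> ? ? ?; apply: leq_trans.
- by move=> ?; apply: leqnn.
- by apply: sort_sorted => U V; apply: leq_total.
Qed.

Lemma passive_divides n E (B : {set {set 'I_n}}) (X Y : {set 'I_n}) (m : 'X_{1..n}) :
    matroid_bases E B -> X \in B -> Y \in B -> X != Y -> (weight X <= weight Y)%N ->
    X \subset supp m :|: Y ->
  exists2 k, k \in passive B Y & k \in supp m.
Proof.
move=> BB XB YB neqXY leXY sXmY.
have [y [k [[yY yX kX kY lt_ky] ZB]]] := light_basis_exchange BB XB YB neqXY leXY.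
exists k; first by apply/passiveP; split=> //; exists y.
by have := subsetP sXmY k kX; rewrite inE (negPf kY) orbF.
Qed.

Definition sort_gens n (B : {set {set 'I_n}}) : seq 'X_{1..n} :=
  [seq squarefree_mon X | X <- sort_bases B].

(** An earlier basis [X] whose monomial divides [m] times that of [Y] forces a passive variable into
    [m] by [passive_divides]. Conversely, for [k] passive through [y], the basis [Y - y + k] is
    lighter than [Y], hence earlier, and its monomial divides [x_k] times that of [Y]. *)
Lemma sort_gens_colonP (K : fieldType) n E (B : {set {set 'I_n}}) Y (p : {mpoly K[n]}) :
    matroid_bases E B -> Y \in B ->
  initial_colon (sort_gens B) (squarefree_mon Y) p <->
  forall m, m \in msupp p -> exists2 k, k \in passive B Y & k \in supp m.
Proof.
move=> BB YB; rewrite initial_colonP index_map; last exact: squarefree_mon_inj.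
rewrite /sort_gens -map_take; split=> Yp m /Yp.
  case=> _ /mapP[X Xs ->]; rewrite squarefree_mon_le supp_addm_squarefree_mon.
  have XB : X \in B by rewrite -mem_sort_bases (mem_take Xs).
  have lt_XY := index_ltn Xs; apply: (passive_divides BB XB YB).
    by apply: contraTneq lt_XY => ->; rewrite ltnn.
  exact/(weight_sort_bases XB YB)/ltnW.
case=> k /passiveP[kY [y [yY lt_ky ZB]]] km; exists (squarefree_mon (k |: Y :\ y)).
  apply: map_f; rewrite in_take ?mem_sort_bases // ltnNge.
  by apply/negP=> /(weight_sort_bases YB ZB); rewrite leqNgt weight_swap.
by rewrite squarefree_mon_le supp_addm_squarefree_mon setUSS ?sub1set ?subsetDl.
Qed.

Lemma sort_gens_set_of (K : fieldType) n E (B : {set {set 'I_n}}) Y k :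
    matroid_bases E B -> Y \in B ->
  @Defs.set_of K n (sort_gens B) (squarefree_mon Y) k <-> k \in passive B Y.
Proof.
move=> BB YB; rewrite /Defs.set_of (sort_gens_colonP _ BB YB) msuppX.
split=> [/(_ U_(k)%MM)|kY m]; rewrite inE; last first.
  by move=> /eqP->; exists k => //; rewrite supp1 inE.
by rewrite eqxx => -[] // j jY; rewrite supp1 inE => /eqP<-.
Qed.

(** * The decomposition function and its regularity *)

Definition first_divisor n (us : seq 'X_{1..n}) (u : 'X_{1..n}) : 'X_{1..n} :=
  nth 0%MM us (find (fun v => v <= u)%MM us).

Lemma first_divisor_decomposition (K : fieldType) n (us : seq 'X_{1..n})
    (I : {mpoly K[n]} -> Prop) :
    enumerates_min_gens us I -> mon_generates (min_gens I) I ->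
  decomposition_function us I (first_divisor us).
Proof.
move=> [_ usP] genI u /(mon_generatesX _ genI)[v /usP vus le_vu].
have dvd_u : has (fun v => v <= u)%MM us by apply/hasP; exists v.
(* [find] counts positions from 0 and [j] counts generators from 1; [dvd_u] ensures that the default
   of [nth] is not reached. *)
exists (find (fun v => v <= u)%MM us).+1; split=> //; first by rewrite -has_find.
  apply/initial_idealX; rewrite (take_nth 0%MM) -?has_find // has_rcons.
  by rewrite (nth_find 0%MM dvd_u).
move=> i /andP[_ lt_i] /initial_idealX/(has_nthP 0%MM)[j].
rewrite size_take_min leq_min => /andP[lt_ji _].
by rewrite nth_take // (before_find 0%MM (leq_trans lt_ji lt_i)).
Qed.

(** Take [m] as large as possible and let [X] be the first basis inside [Y + s]. If [X] differed
    from [Y - m + s], then [light_basis_exchange] would put [m] back in place of some [y > m],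
    making [Y - y + s] a basis and contradicting the choice of [m]. *)
Lemma first_divisor_sort_gens n E (B : {set {set 'I_n}}) Y s :
    matroid_bases E B -> Y \in B -> s \in passive B Y ->
  exists m, [/\ m \in Y, (s < m)%N, s |: Y :\ m \in B,
    forall y, y \in Y -> (m < y)%N -> s |: Y :\ y \notin B
    & first_divisor (sort_gens B) (U_(s) + squarefree_mon Y)%MM =
      squarefree_mon (s |: Y :\ m)].
Proof.
move=> BB YB /passiveP[sY [y0 [y0Y lt_sy0 ZB0]]].
pose P y := [&& y \in Y, (s < y)%N & s |: Y :\ y \in B].
have Py0 : P y0 by rewrite /P y0Y lt_sy0.
case: (arg_maxnP (fun i : 'I_n => i : nat) Py0) => m /and3P[mY lt_sm ZB] max_m.
exists m; split=> // [y yY lt_my|].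
  apply: contraL (lt_my) => VB; rewrite -leqNgt; apply: max_m.
  by rewrite /P yY VB (ltn_trans lt_sm).
pose dvd (X : {set 'I_n}) := X \subset s |: Y.
have -> : first_divisor (sort_gens B) (U_(s) + squarefree_mon Y)%MM =
          squarefree_mon (nth set0 (sort_bases B) (find dvd (sort_bases B))).
  rewrite /first_divisor find_map.
  have eq_dvd : preim (@squarefree_mon n) (fun v => v <= U_(s) + squarefree_mon Y)%MM =1 dvd.
    by move=> X; rewrite /= squarefree_mon_le supp_addm_squarefree_mon supp1.
  rewrite (eq_find eq_dvd) (nth_map set0) // -has_find; apply/hasP.
  by exists Y; rewrite ?mem_sort_bases // /dvd subsetUr.
have dvdZ y : dvd (s |: Y :\ y) by rewrite /dvd setUS ?subsetDl.
have has_dvd : has dvd (sort_bases B).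
  by apply/hasP; exists (s |: Y :\ m); rewrite ?mem_sort_bases.
set X := nth _ _ _; congr squarefree_mon.
have XB : X \in B by rewrite -mem_sort_bases mem_nth -?has_find.
have sX : X \subset s |: Y := nth_find set0 has_dvd.
(* [s |: Y :\ m] satisfies [dvd], so it cannot precede the first basis that does. *)
have leXZ : (weight X <= weight (s |: Y :\ m))%N.
  apply: (weight_sort_bases XB ZB); rewrite leqNgt; apply: contraL (dvdZ m) => lt_ZX.
  rewrite index_uniq -?has_find // ?sort_uniq ?enum_uniq // in lt_ZX.
  by have := before_find set0 lt_ZX; rewrite nth_index ?mem_sort_bases // => ->.
apply/eqP; apply: contraT => neqXZ.
have [y [k [[yZ yX kX kZ lt_ky] VB]]] := light_basis_exchange BB XB ZB neqXZ leXZ.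
(* [m] is the only element of [s |: Y] outside [s |: Y :\ m]. *)
have km : k = m.
  have := subsetP sX k kX; move: kZ; rewrite !inE; case: (k == s) => //=.
  by case: (k =P m) => //= _ /negPf->.
rewrite {k}km in kX kZ lt_ky VB.
have ys : y != s by rewrite -val_eqE neq_ltn (ltn_trans lt_sm lt_ky) orbT.
have yY : y \in Y by move: yZ; rewrite !inE (negPf ys) => /andP[].
have VE : m |: (s |: Y :\ m) :\ y = s |: Y :\ y.
  apply/setP=> i; rewrite !inE.
  have [->|_] /= := eqVneq i m.
    by rewrite mY andbT -val_eqE neq_ltn lt_ky orbT.
  by have [->|] := eqVneq i s; rewrite // eq_sym ys.
have := max_m y; rewrite /P yY -VE VB (ltn_trans lt_sm lt_ky) => /(_ isT).
by rewrite /= leqNgt lt_ky.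
Qed.

Theorem theorem1p10 (K : fieldType) (n : nat) (I : {mpoly K[n]} -> Prop) :
  matroidal I ->
  exists (us : seq 'X_{1..n}) (g : 'X_{1..n} -> 'X_{1..n}),
    [/\ enumerates_min_gens us I,
        linear_quotients K us,
        decomposition_function us I g
      & regular us I g].
Proof.
move=> /matroidal_min_gens[E [B [BB gensP genI]]].
have enum_us : enumerates_min_gens (sort_gens B) I.
  split=> [|u].
    by rewrite map_inj_uniq ?sort_uniq ?enum_uniq //; apply: squarefree_mon_inj.
  rewrite gensP; split=> [/mapP[X]|[X XB ->]].
    by rewrite mem_sort_bases; exists X.
  by apply: map_f; rewrite mem_sort_bases.
exists (sort_gens B), (first_divisor (sort_gens B)); split=> //.
- move=> _ /mapP[Y YB ->]; rewrite mem_sort_bases in YB; exists (passive B Y) => p.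
  by rewrite (sort_gens_colonP _ BB YB) ideal_gen_variablesP.
- exact: first_divisor_decomposition.
- move=> u s /gensP[Y YB ->] /(sort_gens_set_of _ _ BB YB) sY k.
  have [m [mY lt_sm ZB max_m ->]] := first_divisor_sort_gens BB YB sY.
  move=> /(sort_gens_set_of _ _ BB ZB) kZ; apply/(sort_gens_set_of _ _ BB YB).
  have /passiveP[sY' _] := sY.
  exact: (subsetP (passive_exchange BB YB sY' mY lt_sm ZB max_m)).
Qed.
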